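(* Let $L$ be a nilpotent diassociative algebra over a field $\mathbb{F}$, and let $A$ and $B$ be ideals in $L$ such that $L'\subseteq A$ and $B\subseteq Z(L)$. Suppose that $f_{\dashv}(A,B)=0$, $f_{\dashv}(B,A)=0$, $f_{\vdash}(A,B)=0$, and $f_{\vdash}(B,A)=0$ for all $(f_{\dashv},f_{\vdash})\in \mathcal{Z}^2(L,\mathbb{F})$. Then there exists a homomorphism (i.e. an $\mathbb{F}$-linear map) $\delta$ such that the sequence $$\mathcal{H}^2(L/B,\mathbb{F})\xrightarrow{\ \mathrm{Inf}\ }\mathcal{H}^2(L,\mathbb{F})\xrightarrow{\ \delta\ }(L/A\otimes B\oplus B\otimes L/A)^2$$ is exact, where elements of the last term are understood as quadruples of bilinear forms as described in the context.
   Context: A diassociative algebra $L$ over a field $\mathbb{F}$ is an $\mathbb{F}$-vector space with two associative bilinear products $\dashv,\vdash$ satisfying $x\dashv(y\dashv z)=x\dashv(y\vdash z)$, $(x\vdash y)\dashv z=x\vdash(y\dashv z)$, $(x\dashv y)\vdash z=(x\vdash y)\vdash z$ for all $x,y,z\in L$. An ideal $I$ is a subspace closed under both products with $x\dashv i,\ x\vdash i,\ i\dashv x,\ i\vdash x\in I$ for all $i\in I$, $x\in L$. The center $Z(L)$ is the set of $z\in L$ with $z\dashv x=z\vdash x=x\dashv z=x\vdash z=0$ for all $x\in L$. For subalgebras $X,Y$ of $L$, $X\lozenge Y=X\dashv Y+X\vdash Y$, where $X\dashv Y$ and $X\vdash Y$ are the spans of the corresponding products. $L'=L\lozenge L$.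 The lower central series is $L^1=L$, $L^{k+1}=L^1\lozenge L^k+L^2\lozenge L^{k-1}+\cdots+L^k\lozenge L^1$ (so $L^2=L'$); $L$ is nilpotent if $L^{k}=0$ for some $k$. For a diassociative algebra $Q$ over $\mathbb{F}$, $\mathcal{Z}^2(Q,\mathbb{F})$ is the space of pairs $(f_{\dashv},f_{\vdash})$ of bilinear forms $Q\times Q\to\mathbb{F}$ such that for all $i,j,k\in Q$: $f_{\dashv}(i,j\dashv k)=f_{\dashv}(i,j\vdash k)$; $f_{\dashv}(i\vdash j,k)=f_{\vdash}(i,j\dashv k)$; $f_{\vdash}(i\dashv j,k)=f_{\vdash}(i\vdash j,k)$; $f_{\dashv}(i,j\dashv k)=f_{\dashv}(i\dashv j,k)$; $f_{\vdash}(i,j\vdash k)=f_{\vdash}(i\vdash j,k)$. $\mathcal{B}^2(Q,\mathbb{F})$ is the subspace of pairs for which there is a linear map $\varepsilon:Q\to\mathbb{F}$ with $f_{\dashv}(x,y)=-\varepsilon(x\dashv y)$ and $f_{\vdash}(x,y)=-\varepsilon(x\vdash y)$ for all $x,y$; and $\mathcal{H}^2(Q,\mathbb{F})=\mathcal{Z}^2(Q,\mathbb{F})/\mathcal{B}^2(Q,\mathbb{F})$. Notation such as $f_{\dashv}(A,B)=0$ means $f_{\dashv}(a,b)=0$ for all $a\in A$, $b\in B$. The map $\mathrm{Inf}$ sends the class of $(f_{\dashv},f_{\vdash})$ to the class of $(f'_{\dashv},f'_{\vdash})$, where $f'_{\dashv}(x,y)=f_{\dashv}(x+B,y+B)$ and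 $f'_{\vdash}(x,y)=f_{\vdash}(x+B,y+B)$. $(X\otimes Y\oplus Y\otimes X)^2$ denotes $(X\otimes Y\oplus Y\otimes X)\oplus(X\otimes Y\oplus Y\otimes X)$; as the target of $\delta$, its elements are understood as quadruples $(f_1,g_1,f_2,g_2)$ of bilinear forms $f_1,f_2:X\times Y\to\mathbb{F}$ and $g_1,g_2:Y\times X\to\mathbb{F}$ (for finite-dimensional $X,Y$ this space of quadruples is isomorphic to the direct sum of tensor products). *)

(* Defs.v *)
From HB Require Import structures.
From mathcomp Require Import all_boot all_order all_algebra.
From mathcomp Require Import generic_quotient ring_quotient sesquilinear.
From mathcomp Require Import boolp classical_sets functions.

Set Implicit Arguments.
Unset Strict Implicit.
Unset Printing Implicit Defensive.

Import GRing.Theory.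
Local Open Scope quotient_scope.
Local Open Scope classical_set_scope.
Local Open Scope ring_scope.

Reserved Notation "x ⊣ y" (at level 40, left associativity).
Reserved Notation "x ⊢ y" (at level 40, left associativity).
Reserved Notation "X ◊ Y" (at level 40, left associativity).

Section SubmodZmod.
Variables (F : fieldType) (V : lmodType F) (S : submodClosed V).

(* Over a module, [submodClosed] does not inherit from [zmodClosed], which the
   quotient of a Z-module requires. *)
Definition submod_pred : V -> bool := fun x => x \in S.

Let submod_pred_zmod_closed : zmod_closed submod_pred.
Proof.
split=> [|x y Sx Sy]; first exact: rpred0.
by rewrite unfold_in -scaleN1r; apply: rpredD; last exact: rpredZ.
Qed.

HB.instance Definition _ :=
  GRing.isZmodClosed.Build V submod_pred submod_pred_zmod_closed.

Definition submod_zmod : zmodClosed V := GRing.ZmodClosed.clone V submod_pred _.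

Lemma mem_submod_zmod x : (x \in submod_zmod) = (x \in S).
Proof. by []. Qed.

End SubmodZmod.

Section SubspaceType.
Variables (F : fieldType) (V : lmodType F) (S : submodClosed V).

Record subspace_type := SubspaceElt {
  subspace_val :> V;
  subspace_valP : subspace_val \in S }.

HB.instance Definition _ := [isSub for subspace_val].
HB.instance Definition _ := [Choice of subspace_type by <:].
HB.instance Definition _ := [SubChoice_isSubLmodule of subspace_type by <:].

End SubspaceType.

Section QuotientSpace.
Variables (F : fieldType) (V : lmodType F) (S : submodClosed V).

Definition quotient_space := {ideal_quot submod_zmod S}.

HB.instance Definition _ := GRing.Zmodule.on quotient_space.
HB.instance Definition _ := Quotient.on quotient_space.

Definition qclass (x : V) : quotient_space := \pi_{ideal_quot submod_zmod S} x.

Lemma qclass_eq x y : qclass x = qclass y <-> x - y \in S.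
Proof.
by rewrite -mem_submod_zmod Quotient.idealrBE; split=> /eqP.
Qed.

Lemma qclass_repr (q : quotient_space) : qclass (repr (q : {ideal_quot submod_zmod S})) = q.
Proof. exact: reprK. Qed.

Lemma qclass_ind (P : quotient_space -> Prop) :
  (forall x, P (qclass x)) -> forall q, P q.
Proof. by move=> Px q; rewrite -(qclass_repr q). Qed.

Lemma repr_qclass x : repr (qclass x : {ideal_quot submod_zmod S}) - x \in S.
Proof. by apply/qclass_eq; rewrite qclass_repr. Qed.

Lemma qclassD : {morph qclass : x y / x + y}.
Proof. by move=> x y; rewrite /qclass raddfD. Qed.

Definition qscale (a : F) (q : quotient_space) : quotient_space :=
  qclass (a *: repr (q : {ideal_quot submod_zmod S})).

Lemma qscale_qclass a x : qscale a (qclass x) = qclass (a *: x).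
Proof. by apply/qclass_eq; rewrite -scalerBr rpredZ ?repr_qclass. Qed.

Let qscaleA a b q : qscale a (qscale b q) = qscale (a * b) q.
Proof. by elim/qclass_ind: q => x; rewrite !qscale_qclass scalerA. Qed.

Let qscale1 : left_id 1 qscale.
Proof. by elim/qclass_ind=> x; rewrite qscale_qclass scale1r. Qed.

Let qscaleDr : right_distributive qscale +%R.
Proof.
move=> a; elim/qclass_ind=> x; elim/qclass_ind=> y.
by rewrite -qclassD !qscale_qclass -qclassD scalerDr.
Qed.

Let qscaleDl q : {morph qscale^~ q : a b / a + b}.
Proof.
by move=> a b; elim/qclass_ind: q => x; rewrite !qscale_qclass -qclassD scalerDl.
Qed.

HB.instance Definition _ :=
  GRing.Zmodule_isLmodule.Build F quotient_space qscaleA qscale1 qscaleDr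
    qscaleDl.

Lemma qclass_is_linear : linear qclass.
Proof. by move=> a x y; rewrite qclassD -qscale_qclass. Qed.

HB.instance Definition _ :=
  GRing.isLinear.Build F V quotient_space *:%R qclass qclass_is_linear.

End QuotientSpace.

HB.mixin Record Lmodule_isDiassociative (F : fieldType) L
    of GRing.Lmodule F L := {
  ldash : L -> L -> L;
  rdash : L -> L -> L;
  ldash_bilinear : bilinear_for *:%R *:%R ldash;
  rdash_bilinear : bilinear_for *:%R *:%R rdash;
  ldashA : associative ldash;
  rdashA : associative rdash;
  ldash_rdashr : forall x y z, ldash x (ldash y z) = ldash x (rdash y z);
  rdash_ldashA : forall x y z, ldash (rdash x y) z = rdash x (ldash y z);
  rdash_ldashl : forall x y z, rdash (ldash x y) z = rdash (rdash x y) z }.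

#[short(type="diassocType")]
HB.structure Definition Diassociative (F : fieldType) :=
  {L of GRing.Lmodule F L & Lmodule_isDiassociative F L}.

Notation "x ⊣ y" := (ldash x y) : ring_scope.
Notation "x ⊢ y" := (rdash x y) : ring_scope.

HB.mixin Record isDiassocIdeal (F : fieldType) (L : diassocType F)
    (I : {pred L}) := {
  ideal_subproof : forall x i, i \in I ->
    [/\ x ⊣ i \in I, x ⊢ i \in I, i ⊣ x \in I & i ⊢ x \in I] }.

#[short(type="diassocIdeal")]
HB.structure Definition DiassocIdeal (F : fieldType) (L : diassocType F) :=
  {I of GRing.SubmodClosed F I & isDiassocIdeal F L I}.

Section SetProducts.
Variables (F : fieldType) (L : diassocType F).
Implicit Types X Y S : set L.

Definition lspan S : set L :=
  [set v | exists n (a : 'I_n -> F) (s : 'I_n -> L),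
     (forall i, S (s i)) /\ v = \sum_(i < n) a i *: s i].

Definition set_add X Y : set L := [set x + y | x in X & y in Y].

Definition ldash_set X Y : set L := lspan [set x ⊣ y | x in X & y in Y].
Definition rdash_set X Y : set L := lspan [set x ⊢ y | x in X & y in Y].
Definition lozenge X Y : set L := set_add (ldash_set X Y) (rdash_set X Y).

End SetProducts.

Notation "X ◊ Y" := (lozenge X Y) : classical_set_scope.

Section LowerCentralSeries.
Variables (F : fieldType) (L : diassocType F).

Definition derived : set L := setT ◊ setT.

Definition center : set L :=
  [set z | forall x : L, [/\ z ⊣ x = 0, z ⊢ x = 0, x ⊣ z = 0 & x ⊢ z = 0]].

(* [lcs_seq k] is the list of L^1, ..., L^(k+1); the recursion is
   course-of-values. *)
Fixpoint lcs_seq (k : nat) : seq (set L) :=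
  if k is k'.+1 then
    let s := lcs_seq k' in
    rcons s (\big[@set_add F L/[set 0]]_(i < k)
               (nth setT s i ◊ nth setT s (k' - i)))
  else [:: setT].

(* The term of index [n] is L^n for n > 0; L^0 is a dummy value. *)
Definition lcs (n : nat) : set L := nth setT (lcs_seq n.-1) n.-1.

Lemma size_lcs_seq k : size (lcs_seq k) = k.+1.
Proof. by elim: k => //= k IHk; rewrite size_rcons IHk. Qed.

Lemma nth_lcs_seq i k : (i <= k)%N -> nth setT (lcs_seq k) i = lcs i.+1.
Proof.
elim: k => [|k IHk]; first by rewrite leqn0 => /eqP ->.
rewrite leq_eqVlt => /predU1P[-> //|]; rewrite ltnS => leik.
by rewrite /= nth_rcons size_lcs_seq ltnS leik IHk.
Qed.

Lemma lcs1 : lcs 1 = setT.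
Proof. by []. Qed.

Lemma lcsS k : lcs k.+2 =
  \big[@set_add F L/[set 0]]_(i < k.+1) (lcs i.+1 ◊ lcs (k.+1 - i)).
Proof.
rewrite /lcs /= nth_rcons size_lcs_seq ltnn eqxx; apply: eq_bigr => i _.
have leik : (i <= k)%N by rewrite -ltnS.
by rewrite !nth_lcs_seq ?leq_subr // subSn.
Qed.

Definition nilpotent : Prop := exists2 k, (0 < k)%N & lcs k = [set 0].

End LowerCentralSeries.

Arguments derived {F} L.
Arguments center {F} L.
Arguments lcs {F} L n.
Arguments nilpotent {F} L.

Section BilinearRules.
Variables (F : fieldType) (U V W : lmodType F) (f : U -> V -> W).
Hypothesis fbil : bilinear_for *:%R *:%R f.

Lemma bilinBl x x' y : f (x - x') y = f x y - f x' y.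
Proof. exact: (zmod_morphism_linear (fbil.1 y)). Qed.

Lemma bilinBr x y y' : f x (y - y') = f x y - f x y'.
Proof. exact: (zmod_morphism_linear (fbil.2 x)). Qed.

End BilinearRules.

Section QuotientAlgebra.
Variables (F : fieldType) (L : diassocType F) (I : diassocIdeal L).

Local Notation Q := (quotient_space I).
Local Notation repr q := (repr (q : {ideal_quot submod_zmod I})).

Definition qldash (p q : Q) : Q := qclass I (repr p ⊣ repr q).
Definition qrdash (p q : Q) : Q := qclass I (repr p ⊢ repr q).

Let qdashE (op : L -> L -> L) (opB : bilinear_for *:%R *:%R op)
    (opI : forall x i, i \in I -> op x i \in I /\ op i x \in I) x y :
  qclass I (op (repr (qclass I x)) (repr (qclass I y))) = qclass I (op x y).
Proof.
apply/qclass_eq; rewrite -(subrK (op (repr (qclass I x)) y) (op _ _)).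
rewrite -(bilinBr opB) -addrA -(bilinBl opB); apply: rpredD.
  by apply: (opI _ _ _).1; apply: repr_qclass.
by apply: (opI _ _ _).2; apply: repr_qclass.
Qed.

Lemma qldash_qclass x y : qldash (qclass I x) (qclass I y) = qclass I (x ⊣ y).
Proof.
apply: (qdashE ldash_bilinear) => z i /(@ideal_subproof _ _ I z).
by case=> ? ? ? ?.
Qed.

Lemma qrdash_qclass x y : qrdash (qclass I x) (qclass I y) = qclass I (x ⊢ y).
Proof.
apply: (qdashE rdash_bilinear) => z i /(@ideal_subproof _ _ I z).
by case=> ? ? ? ?.
Qed.

Let qldash_bilinear : bilinear_for *:%R *:%R qldash.
Proof.
split; elim/qclass_ind=> z a; elim/qclass_ind=> x; elim/qclass_ind=> y.
  by rewrite -linearP !qldash_qclass -linearP (ldash_bilinear.1 z).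
by rewrite -linearP !qldash_qclass -linearP (ldash_bilinear.2 z).
Qed.

Let qrdash_bilinear : bilinear_for *:%R *:%R qrdash.
Proof.
split; elim/qclass_ind=> z a; elim/qclass_ind=> x; elim/qclass_ind=> y.
  by rewrite -linearP !qrdash_qclass -linearP (rdash_bilinear.1 z).
by rewrite -linearP !qrdash_qclass -linearP (rdash_bilinear.2 z).
Qed.

Let qdash_qclass := (qldash_qclass, qrdash_qclass).

Let qldashA : associative qldash.
Proof.
by do 3!elim/qclass_ind=> ?; rewrite !qdash_qclass ldashA.
Qed.

Let qrdashA : associative qrdash.
Proof.
by do 3!elim/qclass_ind=> ?; rewrite !qdash_qclass rdashA.
Qed.

Let qldash_rdashr x y z : qldash x (qldash y z) = qldash x (qrdash y z).
Proof.
move: x y z; do 3!elim/qclass_ind=> ?.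
by rewrite !qdash_qclass ldash_rdashr.
Qed.

Let qrdash_ldashA x y z : qldash (qrdash x y) z = qrdash x (qldash y z).
Proof.
move: x y z; do 3!elim/qclass_ind=> ?.
by rewrite !qdash_qclass rdash_ldashA.
Qed.

Let qrdash_ldashl x y z : qrdash (qldash x y) z = qrdash (qrdash x y) z.
Proof.
move: x y z; do 3!elim/qclass_ind=> ?.
by rewrite !qdash_qclass rdash_ldashl.
Qed.

HB.instance Definition _ :=
  Lmodule_isDiassociative.Build F Q qldash_bilinear qrdash_bilinear
    qldashA qrdashA qldash_rdashr qrdash_ldashA qrdash_ldashl.

Lemma qclass_ldash x y : qclass I x ⊣ qclass I y = qclass I (x ⊣ y) :> Q.
Proof. exact: qldash_qclass. Qed.

Lemma qclass_rdash x y : qclass I x ⊢ qclass I y = qclass I (x ⊢ y) :> Q.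
Proof. exact: qrdash_qclass. Qed.

End QuotientAlgebra.

Section BilinearForms.
Variables (F : fieldType) (X Y : lmodType F).

Definition is_bilform : {pred X -> Y -> F^o} :=
  fun f => `[< bilinear_for *:%R *:%R f >].

Let is_bilform_closed : submod_closed is_bilform.
Proof.
split=> [|a f g /asboolP[fl fr] /asboolP[gl gr]]; apply/asboolP; split=> u b v w.
- by change (0 = b *: 0 + 0 :> F^o); rewrite scaler0 addr0.
- by change (0 = b *: 0 + 0 :> F^o); rewrite scaler0 addr0.
- change (a *: f (b *: v + w) u + g (b *: v + w) u
    = b *: (a *: f v u + g v u) + (a *: f w u + g w u)).
  by rewrite fl gl !scalerDr !scalerA mulrC addrACA.
- change (a *: f u (b *: v + w) + g u (b *: v + w)
    = b *: (a *: f u v + g u v) + (a *: f u w + g u w)).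
  by rewrite fr gr !scalerDr !scalerA mulrC addrACA.
Qed.

HB.instance Definition _ :=
  GRing.isSubmodClosed.Build F (X -> Y -> F^o) is_bilform is_bilform_closed.

Record bilform := Bilform {
  bilform_fun :> X -> Y -> F^o;
  bilform_funP : bilform_fun \in is_bilform }.

HB.instance Definition _ := [isSub for bilform_fun].
HB.instance Definition _ := [Choice of bilform by <:].
HB.instance Definition _ := [SubChoice_isSubLmodule of bilform by <:].

Lemma bilform_bilinear (f : bilform) : bilinear_for *:%R *:%R f.
Proof. exact/asboolP/bilform_funP. Qed.

Lemma bilform_eqP (f g : bilform) : (forall x y, f x y = g x y) <-> f = g.
Proof.
split=> [fg | -> //]; apply: val_inj.
by apply/funext=> x; apply/funext=> y; apply: fg.
Qed.

Lemma bilform_linE (a : F) (f g : bilform) x y :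
  (a *: f + g) x y = a *: f x y + g x y.
Proof. by []. Qed.

Definition mk_bilform (f : X -> Y -> F^o) (fP : bilinear_for *:%R *:%R f) :=
  Bilform (introT (asboolP _) fP : f \in is_bilform).

End BilinearForms.

Section Cohomology.
Variables (F : fieldType) (Q : diassocType F).

Definition cocycle_axiom (f : bilform Q Q * bilform Q Q) : Prop :=
  forall i j k : Q,
    [/\ f.1 i (j ⊣ k) = f.1 i (j ⊢ k),
        f.1 (i ⊢ j) k = f.2 i (j ⊣ k),
        f.2 (i ⊣ j) k = f.2 (i ⊢ j) k,
        f.1 i (j ⊣ k) = f.1 (i ⊣ j) k &
        f.2 i (j ⊢ k) = f.2 (i ⊢ j) k].

Definition is_cocycle : {pred bilform Q Q * bilform Q Q} :=
  fun f => `[< cocycle_axiom f >].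

Let is_cocycle_closed : submod_closed is_cocycle.
Proof.
split=> [|a f g /asboolP fP /asboolP gP]; apply/asboolP=> i j k //.
have [f1 f2 f3 f4 f5] := fP i j k; have [g1 g2 g3 g4 g5] := gP i j k.
by split; rewrite !bilform_linE;
   rewrite ?(f1, f2, f3, f4, f5, g1, g2, g3, g4, g5) -?(f1, f4, g1, g4).
Qed.

HB.instance Definition _ :=
  GRing.isSubmodClosed.Build F (bilform Q Q * bilform Q Q)%type is_cocycle
    is_cocycle_closed.

Record Z2 := Cocycle {
  cocycle_forms :> bilform Q Q * bilform Q Q;
  cocycle_formsP : cocycle_forms \in is_cocycle }.

HB.instance Definition _ := [isSub for cocycle_forms].
HB.instance Definition _ := [Choice of Z2 by <:].
HB.instance Definition _ := [SubChoice_isSubLmodule of Z2 by <:].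

Lemma cocycleP (f : Z2) : cocycle_axiom f.
Proof. exact/asboolP/cocycle_formsP. Qed.

Definition B2 : {pred Z2} :=
  fun f => `[< exists e : {linear Q -> F^o},
    forall x y, f.1 x y = - e (x ⊣ y) /\ f.2 x y = - e (x ⊢ y) >].

Let B2_closed : submod_closed B2.
Proof.
split=> [|a f g /asboolP[d dP] /asboolP[e eP]]; apply/asboolP.
  by exists \0 => x y; rewrite oppr0.
exists (a \*: d \+ e) => x y; have [f1 f2] := dP x y; have [g1 g2] := eP x y.
by rewrite !bilform_linE f1 f2 g1 g2 /= !opprD !scalerN.
Qed.

HB.instance Definition _ := GRing.isSubmodClosed.Build F Z2 B2 B2_closed.

Definition B2_submod : submodClosed Z2 := GRing.SubmodClosed.clone F Z2 B2 _.

Definition H2 : lmodType F := quotient_space B2_submod.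

Definition H2_class (f : Z2) : H2 := qclass B2_submod f.

End Cohomology.

Section Inflation.
Variables (F : fieldType) (L : diassocType F) (B : diassocIdeal L).

Local Notation Q := (quotient_space B).

Let pullback_bilinear (f : bilform Q Q) :
  bilinear_for *:%R *:%R
    (fun x y : L => f (qclass B x) (qclass B y)).
Proof.
split=> u a v w; rewrite linearP.
  exact: (bilform_bilinear f).1.
exact: (bilform_bilinear f).2.
Qed.

Definition pullback (f : bilform Q Q) : bilform L L :=
  mk_bilform (pullback_bilinear f).

Let pullback_cocycle (f : Z2 Q) :
  (pullback f.1, pullback f.2) \in @is_cocycle F L.
Proof.
apply/asboolP => i j k.
by have := cocycleP f (qclass B i) (qclass B j) (qclass B k);
   rewrite !(qclass_ldash, qclass_rdash).
Qed.

Definition Z2_pullback (f : Z2 Q) : Z2 L := Cocycle (pullback_cocycle f).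

Lemma Z2_pullbackE (f : Z2 Q) x y :
  (Z2_pullback f).1 x y = f.1 (qclass B x) (qclass B y) /\
  (Z2_pullback f).2 x y = f.2 (qclass B x) (qclass B y).
Proof. by []. Qed.

Lemma Z2_pullback_is_linear : linear Z2_pullback.
Proof.
by move=> a f g; apply: val_inj; congr (_, _); apply/bilform_eqP.
Qed.

Lemma Z2_pullback_B2 (f : Z2 Q) : f \in @B2 F Q -> Z2_pullback f \in @B2 F L.
Proof.
move=> /asboolP[e eP]; apply/asboolP.
exists (e \o qclass B : {linear L -> F^o}) => x y.
have [E1 E2] := eP (qclass B x) (qclass B y).
by rewrite /= E1 E2 qclass_ldash qclass_rdash.
Qed.

Definition Inf (h : H2 Q) : H2 L :=
  H2_class (Z2_pullback (repr (h : {ideal_quot submod_zmod (B2_submod Q)}))).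

Lemma Inf_H2_class (f : Z2 Q) : Inf (H2_class f) = H2_class (Z2_pullback f).
Proof.
have pB (x y : Z2 Q) : Z2_pullback (x - y) = Z2_pullback x - Z2_pullback y.
  exact: (zmod_morphism_linear Z2_pullback_is_linear).
by apply/qclass_eq; rewrite -pB; apply/Z2_pullback_B2/repr_qclass.
Qed.

Lemma Inf_is_linear : linear Inf.
Proof.
move=> a; elim/qclass_ind=> f; elim/qclass_ind=> g.
rewrite -linearP -!/(H2_class _) !Inf_H2_class Z2_pullback_is_linear.
exact: linearP.
Qed.

HB.instance Definition _ :=
  GRing.isLinear.Build F (H2 Q) (H2 L) *:%R Inf Inf_is_linear.

End Inflation.

Arguments Inf {F L} B h.

(* The quadruples (f_1, g_1, f_2, g_2) with f_i on X * Y and g_i on Y * X: this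
   stands for (X (x) Y (+) Y (x) X)^2, to which it is isomorphic when X and Y
   are finite-dimensional. *)
Definition bilform_quad (F : fieldType) (X Y : lmodType F) : lmodType F :=
  ((bilform X Y * bilform Y X) * (bilform X Y * bilform Y X))%type.

Definition exact_at (F : fieldType) (U V W : lmodType F)
    (f : {linear U -> V}) (g : {linear V -> W}) : Prop :=
  range f = [set v | g v = 0].

(* Main.v *)
Require Import Defs.
From HB Require Import structures.
From mathcomp Require Import all_boot all_algebra.
From mathcomp Require Import generic_quotient ring_quotient sesquilinear.
From mathcomp Require Import boolp classical_sets.

(** The connecting map delta sends the class of a cocycle (f, g) to the
    restrictions of f and g to L x B and B x L. These restrictions kill A in the
    L-variable, by the hypothesis on cocycles, so they are quadruples of forms
    on L/A and B. And delta is well defined on classes: a coboundary takes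
    values - e (z), with e linear and z a product of x and y, and z = 0 as soon
    as x or y lies in B, since B is central.

    A cocycle inflated from L/B vanishes as soon as one argument lies in B, so
    delta kills the image of Inf. Conversely, if delta kills the class of
    (f, g), then f and g themselves (and not only up to a coboundary) vanish on
    L x B and B x L; hence they descend to L/B ([quot_form]), the descended
    forms are again a cocycle ([Z2_descend]), and its inflation is (f, g). *)

Set Implicit Arguments.
Unset Strict Implicit.
Unset Printing Implicit Defensive.

Import GRing.Theory.
Local Open Scope classical_set_scope.
Local Open Scope ring_scope.

(** A chosen representative of a class modulo a subspace. *)
Definition qrepr (F : fieldType) (V : lmodType F) (S : submodClosed V)
    (q : quotient_space S) : V :=
  generic_quotient.repr (q : {ideal_quot submod_zmod S}).

Section QuotientLift.
Variables (F : fieldType) (V W : lmodType F) (S : submodClosed V).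
Variables (g : {linear V -> W}) (g0 : forall x, x \in S -> g x = 0).

(** The linear map induced on V/S by a linear map that vanishes on S. The proof
    of vanishing is an argument, although the underlying function ignores it, so
    that linearity can be declared for every such map. *)
Definition quot_lift of (forall x, x \in S -> g x = 0) :=
  fun q : quotient_space S => g (qrepr q).

Lemma quot_lift_qclass x : quot_lift g0 (qclass S x) = g x.
Proof.
by apply/eqP; rewrite -subr_eq0 -linearB; apply/eqP/g0/repr_qclass.
Qed.

Lemma quot_lift_is_linear : linear (quot_lift g0).
Proof.
move=> a; elim/qclass_ind=> x; elim/qclass_ind=> y.
by rewrite -linearP !quot_lift_qclass linearP.
Qed.

HB.instance Definition _ :=
  GRing.isLinear.Build F (quotient_space S) W *:%R (quot_lift g0)
    quot_lift_is_linear.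

End QuotientLift.

Section FormsOnQuotients.
Variables (F : fieldType).

Section Flip.
Variables (V W : lmodType F).

Lemma flip_bilinear (f : bilform V W) :
  bilinear_for *:%R *:%R (fun y x => f x y).
Proof. by have [fl fr] := bilform_bilinear f; split. Qed.

(** The form with its two arguments exchanged. *)
Definition flip_form (f : bilform V W) : bilform W V :=
  mk_bilform (flip_bilinear f).

End Flip.

Lemma eq_bilform_l (V W : lmodType F) (S : submodClosed V) (f : bilform V W)
    (x x' : V) (y : W) :
  (forall s, s \in S -> f s y = 0) -> x - x' \in S -> f x y = f x' y.
Proof.
move=> f0 /f0; rewrite (bilinBl (bilform_bilinear f)) => /eqP.
by rewrite subr_eq0 => /eqP.
Qed.

Section QuotSub.
Variables (V W : lmodType F) (S : submodClosed V) (T : submodClosed W).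
Variables (f : bilform V W) (f0 : forall s t, s \in S -> t \in T -> f s t = 0).

Let g (q : quotient_space S) (t : subspace_type T) : F^o := f (qrepr q) (val t).

Let gE x t : g (qclass S x) t = f x (val t).
Proof.
apply: (@eq_bilform_l _ _ S); last exact: repr_qclass.
by move=> s Ss; apply: f0 => //; apply: subspace_valP.
Qed.

Let g_bilinear : bilinear_for *:%R *:%R g.
Proof.
split=> [t a|]; last by move=> q a t u; apply: (bilform_bilinear f).2.
elim/qclass_ind=> x; elim/qclass_ind=> y; rewrite -linearP !gE.
exact: (bilform_bilinear f).1.
Qed.

(** The form on V/S x T induced by a form on V x W that vanishes on S x T. *)
Definition quot_sub_form : bilform (quotient_space S) (subspace_type T) :=
  mk_bilform g_bilinear.

Lemma quot_sub_formE x t : quot_sub_form (qclass S x) t = f x (val t).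
Proof. exact: gE. Qed.

End QuotSub.

Section QuotQuot.
Variables (V : lmodType F) (S : submodClosed V) (f : bilform V V).
Variables (f0l : forall s x, s \in S -> f s x = 0).
Variables (f0r : forall x s, s \in S -> f x s = 0).

Let g (p q : quotient_space S) : F^o := f (qrepr p) (qrepr q).

Let gE x y : g (qclass S x) (qclass S y) = f x y.
Proof.
transitivity (f x (qrepr (qclass S y))).
  apply: (@eq_bilform_l _ _ S); last exact: repr_qclass.
  by move=> s; apply: f0l.
apply: (@eq_bilform_l _ _ S (flip_form f)); last exact: repr_qclass.
by move=> s; apply: f0r.
Qed.

Let g_bilinear : bilinear_for *:%R *:%R g.
Proof.
split; elim/qclass_ind=> z a; elim/qclass_ind=> x; elim/qclass_ind=> y.
  by rewrite -linearP !gE; apply: (bilform_bilinear f).1.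
by rewrite -linearP !gE; apply: (bilform_bilinear f).2.
Qed.

(** The form on V/S x V/S induced by a form on V x V whose two radicals
    contain S. *)
Definition quot_form : bilform (quotient_space S) (quotient_space S) :=
  mk_bilform g_bilinear.

Lemma quot_formE x y : quot_form (qclass S x) (qclass S y) = f x y.
Proof. exact: gE. Qed.

End QuotQuot.

End FormsOnQuotients.

Section Descent.
Variables (F : fieldType) (L : diassocType F) (B : diassocIdeal L) (f : Z2 L).
Hypothesis f0 : forall x b, b \in B ->
  [/\ f.1 x b = 0, f.1 b x = 0, f.2 x b = 0 & f.2 b x = 0].

Local Notation Q := (quotient_space B).

(** A cocycle that vanishes on L x B and B x L is the pullback of a cocycle of
    L/B, and not only cohomologous to one. *)
Lemma Z2_descend : exists f' : Z2 Q, Z2_pullback f' = f.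
Proof.
have l1 s x : s \in B -> f.1 s x = 0 by case/(f0 x).
have r1 x s : s \in B -> f.1 x s = 0 by case/(f0 x).
have l2 s x : s \in B -> f.2 s x = 0 by case/(f0 x).
have r2 x s : s \in B -> f.2 x s = 0 by case/(f0 x).
have cf : (quot_form l1 r1, quot_form l2 r2) \in @is_cocycle F Q.
  apply/asboolP; elim/qclass_ind=> i; elim/qclass_ind=> j.
  elim/qclass_ind=> k; rewrite !(qclass_ldash, qclass_rdash).
  rewrite -[(_, _).1]/(quot_form l1 r1) -[(_, _).2]/(quot_form l2 r2).
  by rewrite !quot_formE; apply: cocycleP.
exists (Cocycle cf); apply: val_inj => /=.
rewrite [RHS]surjective_pairing; congr (_, _).
  by apply/bilform_eqP=> x y; apply: (quot_formE l1 r1).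
by apply/bilform_eqP=> x y; apply: (quot_formE l2 r2).
Qed.

End Descent.

Section Delta.
Variables (F : fieldType) (L : diassocType F) (A B : diassocIdeal L).
Hypothesis BZ : [set` B] `<=` center L.
Hypothesis AB0 : forall (f : Z2 L) (a b : L), a \in A -> b \in B ->
  [/\ f.1 a b = 0, f.1 b a = 0, f.2 a b = 0 & f.2 b a = 0].

Local Notation quad :=
  (bilform_quad (quotient_space A) (subspace_type B)).

Let AB1 (f : Z2 L) a b : a \in A -> b \in B -> f.1 a b = 0.
Proof. by move=> Aa Bb; case: (AB0 f Aa Bb). Qed.

Let BA1 (f : Z2 L) a b : a \in A -> b \in B -> flip_form f.1 a b = 0.
Proof. by move=> Aa Bb; case: (AB0 f Aa Bb). Qed.

Let AB2 (f : Z2 L) a b : a \in A -> b \in B -> f.2 a b = 0.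
Proof. by move=> Aa Bb; case: (AB0 f Aa Bb). Qed.

Let BA2 (f : Z2 L) a b : a \in A -> b \in B -> flip_form f.2 a b = 0.
Proof. by move=> Aa Bb; case: (AB0 f Aa Bb). Qed.

(** The restrictions of the two forms of a cocycle to L x B and B x L, viewed as
    forms on L/A x B and B x L/A. *)
Definition restr_quad (f : Z2 L) : quad :=
  ((quot_sub_form (@AB1 f), flip_form (quot_sub_form (@BA1 f))),
   (quot_sub_form (@AB2 f), flip_form (quot_sub_form (@BA2 f)))).

Lemma restr_quad_is_linear : linear restr_quad.
Proof. by move=> a f g; congr ((_, _), (_, _)); apply/bilform_eqP. Qed.

HB.instance Definition _ :=
  GRing.isLinear.Build F (Z2 L) quad *:%R restr_quad restr_quad_is_linear.

Lemma restr_quad_eq0 (f : Z2 L) : restr_quad f = 0 <->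
  forall x b, b \in B ->
    [/\ f.1 x b = 0, f.1 b x = 0, f.2 x b = 0 & f.2 b x = 0].
Proof.
split=> [q0 x b Bb|f0].
  pose y := qclass A x; pose t := SubspaceElt Bb.
  (* Evaluating the four forms at x + A and b gives the four values. *)
  have ev (e : quad -> F^o) : e (restr_quad f) = e 0 by rewrite q0.
  split.
  - by rewrite -(quot_sub_formE (@AB1 f) x t); apply: (ev (fun q => q.1.1 y t)).
  - rewrite -[LHS](quot_sub_formE (@BA1 f) x t).
    exact: (ev (fun q => q.1.2 t y)).
  - by rewrite -(quot_sub_formE (@AB2 f) x t); apply: (ev (fun q => q.2.1 y t)).
  - rewrite -[LHS](quot_sub_formE (@BA2 f) x t).
    exact: (ev (fun q => q.2.2 t y)).
congr ((_, _), (_, _)); apply/bilform_eqP=> u v /=.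
- by case: (f0 (qrepr u) (val v) (subspace_valP v)).
- by case: (f0 (qrepr v) (val u) (subspace_valP u)).
- by case: (f0 (qrepr u) (val v) (subspace_valP v)).
- by case: (f0 (qrepr v) (val u) (subspace_valP u)).
Qed.

Lemma restr_quad_B2 (f : Z2 L) : f \in B2_submod L -> restr_quad f = 0.
Proof.
move=> /asboolP[e eP]; apply/restr_quad_eq0 => x b Bb.
have [bx1 bx2 xb1 xb2] := BZ Bb x.
have [fxb1 fxb2] := eP x b; have [fbx1 fbx2] := eP b x.
by rewrite fxb1 fxb2 fbx1 fbx2 bx1 bx2 xb1 xb2 linear0 oppr0.
Qed.

(** The connecting map on cohomology: restriction of cocycles, which is well
    defined since the restriction of a coboundary is zero. *)
Definition delta : {linear H2 L -> quad} := quot_lift restr_quad_B2.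

Lemma delta_H2_class (f : Z2 L) : delta (H2_class f) = restr_quad f.
Proof. exact: quot_lift_qclass. Qed.

Lemma exact_Inf_delta : exact_at (Inf B) delta.
Proof.
rewrite /exact_at predeqE; elim/qclass_ind=> f; rewrite -/(H2_class f).
split=> [[h _ <-]|].
  elim/qclass_ind: h => h.
  apply: etrans (congr1 delta (Inf_H2_class h)) _.
  apply: etrans (delta_H2_class _) _.
  apply/restr_quad_eq0 => x b Bb.
  have b0 : qclass B b = 0.
    by rewrite -(linear0 (qclass B)); apply/qclass_eq; rewrite subr0.
  have [xb1 xb2] := Z2_pullbackE h x b; have [bx1 bx2] := Z2_pullbackE h b x.
  have r0 (g : bilform (quotient_space B) (quotient_space B)) q : g q 0 = 0.
    by rewrite -(subrr 0) (bilinBr (bilform_bilinear g)) subrr.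
  have l0 (g : bilform (quotient_space B) (quotient_space B)) q : g 0 q = 0.
    exact: (r0 (flip_form g)).
  by rewrite xb1 xb2 bx1 bx2 b0 !r0 !l0.
move=> /(etrans (esym (delta_H2_class f))) /restr_quad_eq0 /Z2_descend[f' <-].
by exists (H2_class f'); last exact: Inf_H2_class.
Qed.

End Delta.

Theorem theorem3p1 (F : fieldType) (L : diassocType F)
    (A B : diassocIdeal L) :
  nilpotent L ->
  derived L `<=` [set` A] ->
  [set` B] `<=` center L ->
  (forall (f : Z2 L) (a b : L), a \in A -> b \in B ->
     [/\ f.1 a b = 0, f.1 b a = 0, f.2 a b = 0 & f.2 b a = 0]) ->
  exists delta : {linear H2 L ->
      bilform_quad (quotient_space A) (subspace_type B)},
    exact_at (Inf B) delta.
Proof.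
by move=> _ _ BZ AB0; exists (delta BZ AB0); apply: exact_Inf_delta.
Qed.
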